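(* Assume $\mathfrak{c} = \mathfrak{c}^{<\mathfrak{c}}$ is a successor cardinal, where $\mathfrak c = 2^{\aleph_0}$. Fix $R \in \{\in^*, \leq^*, \neq^*\}$ and $\mathcal I \in \{\mathcal K, \mathcal M, \mathcal N\}$. If $\mathfrak b(R) = {\rm add}(\mathcal I) = \mathfrak{c}$ then $\mathfrak b(R_\mathcal I) = \mathfrak b_\mathfrak{c}$ and $\mathfrak{d}(R_\mathcal I) = \mathfrak{d}_\mathfrak{c}$. In particular, under $\mathsf{CH}$, $\mathfrak b(R_\mathcal I) = \mathfrak b_{\aleph_1}$ and $\mathfrak{d}(R_\mathcal I) = \mathfrak{d}_{\aleph_1}$ for all such $R$ and $\mathcal I$.
   Context: A slalom is a function $s:\omega \to [\omega]^{<\omega}$ with $|s(n)| \le n$ for all $n$; $\mathcal S$ is the set of slaloms. For $x,y\in\omega^\omega$, $s \in \mathcal S$: $x \leq^* y$ iff $x(k)\le y(k)$ for all but finitely many $k$; $x \neq^* y$ iff $x(k)\neq y(k)$ for all but finitely many $k$; $x \in^* s$ iff $x(k)\in s(k)$ for all but finitely many $k$. $\mathfrak b(R)$ is the least size of a set $A\subseteq\omega^\omega$ with no single $y$ (in $\omega^\omega$, or in $\mathcal S$ if $R=\in^*$) with $xRy$ for all $x\in A$. $\mathcal N$, $\mathcal M$, $\mathcal K$ are the ideals on $\omega^\omega$ of null sets, meager sets, and sets contained in a $\sigma$-compact set. For an ideal $\mathcal I$ and $f:\omega^\omega\to\omega^\omega$, $g:\omega^\omega\to\omega^\omega$ (or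 $g:\omega^\omega\to\mathcal S$ when $R=\in^*$), $f R_\mathcal I g$ iff $\{x : \neg(f(x) R g(x))\} \in \mathcal I$. $\mathfrak b(R_\mathcal I)$ is the least size of a family of functions $\omega^\omega\to\omega^\omega$ not $R_\mathcal I$-bounded by a single $g$; $\mathfrak d(R_\mathcal I)$ is the least size of a family $D$ of $g$'s such that every $f:\omega^\omega\to\omega^\omega$ satisfies $f R_\mathcal I g$ for some $g\in D$. For a cardinal $\kappa$ and $f,g\in\kappa^\kappa$, $f\le^* g$ iff $\{\alpha<\kappa: f(\alpha)>g(\alpha)\}$ is bounded in $\kappa$; $\mathfrak b_\kappa$ and $\mathfrak d_\kappa$ are the least size of an unbounded, respectively dominating, subset of $\kappa^\kappa$ for this relation. *)

(* Defs.v *)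
From HB Require Import structures.
From mathcomp Require Import all_boot all_order all_algebra finmap.
From mathcomp Require Import all_classical all_reals all_analysis.
From mathcomp Require Import wochoice.

Set Implicit Arguments.
Unset Strict Implicit.
Unset Printing Implicit Defensive.

Import Order.TTheory GRing.Theory Num.Theory.

Local Open Scope classical_set_scope.
Local Open Scope card_scope.
Local Open Scope ring_scope.

(** * Cardinals *)

(* A cardinal is an initial ordinal: a well-ordered type that is not equipotent
   to any of its proper initial segments.  [cle] is the reflexive order. *)
Record cardinal : Type := Cardinal {
  cardinal_sort :> Type;
  cle : rel cardinal_sort;
  cle_wo : well_order cle;
  cle_initial : forall a : cardinal_sort,
    ~ ([set: cardinal_sort] #<= [set x | ~~ cle a x]) }.

Arguments cle {c} : rename.

Definition clt (k : cardinal) (a b : k) : bool := ~~ cle b a.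

(* "k is the least size of a set A such that P A" *)
Definition least_size (T : Type) (P : set (set T)) (k : cardinal) : Prop :=
  (exists2 A, P A & A #= [set: k]) /\ (forall A, P A -> [set: k] #<= A).

Definition is_continuum (k : cardinal) : Prop := [set: k] #= [set: nat -> bool].

Definition card_lt (k l : cardinal) : Prop := ~ ([set: l] #<= [set: k]).

Definition is_succ_of (m k : cardinal) : Prop :=
  card_lt m k /\ forall l : cardinal, card_lt m l -> [set: k] #<= [set: l].

Definition is_successor_cardinal (k : cardinal) : Prop :=
  exists m : cardinal, is_succ_of m k.

Definition is_aleph1 (k : cardinal) : Prop :=
  exists2 m : cardinal, [set: m] #= [set: nat] & is_succ_of m k.

Definition CH : Prop := exists2 k : cardinal, is_aleph1 k & is_continuum k.

(* The set of all maps from some ordinal a < k to k; its size is k^{<k}. *)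
Definition lt_functions (k : cardinal) : Type := {a : k & {x : k | clt x a} -> k}.

(** * Bounding and dominating families of a relation *)

Definition unbounded (X Y : Type) (R : X -> Y -> Prop) : set (set X) :=
  [set A | ~ exists y, forall x, A x -> R x y].

Definition dominating (X Y : Type) (R : X -> Y -> Prop) : set (set Y) :=
  [set D | forall x, exists2 y, D y & R x y].

(* [is_b R k] is b(R) = k and [is_d R k] is d(R) = k. *)
Definition is_b (X Y : Type) (R : X -> Y -> Prop) (k : cardinal) : Prop :=
  least_size (unbounded R) k.

Definition is_d (X Y : Type) (R : X -> Y -> Prop) (k : cardinal) : Prop :=
  least_size (dominating R) k.

(* The order f <=* g on k^k. *)
Definition cle_star (k : cardinal) (f g : k -> k) : Prop :=
  exists b : k, forall a : k, clt (g a) (f a) -> clt a b.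

(** * Relations on the Baire space *)

Definition baire : Type := prod_topology (fun _ : nat => nat).
HB.instance Definition _ := Topological.on baire.

Record slalom : Type := Slalom {
  slalom_fun :> nat -> {fset nat};
  slalom_card : forall n, (#|` slalom_fun n| <= n)%N }.

(* The relations of interest have different right-hand types (reals or
   slaloms), so a relation is packed with its right-hand type. *)
Record baire_rel : Type := BaireRel {
  rel_target : Type;
  rel_holds :> baire -> rel_target -> Prop }.

Definition in_star : baire_rel :=
  BaireRel (fun (x : baire) (s : slalom) => \forall k \near \oo, x k \in s k).

Definition le_star : baire_rel :=
  BaireRel (fun x y : baire => \forall k \near \oo, (x k <= y k)%N).

Definition neq_star : baire_rel :=
  BaireRel (fun x y : baire => \forall k \near \oo, x k != y k).

(* R_I, for a relation R and an ideal I. *)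
Definition lift_rel (R : baire_rel) (I : set (set baire))
    (f : baire -> baire) (g : baire -> rel_target R) : Prop :=
  I [set x | ~ R (f x) (g x)].

(** * Ideals on the Baire space *)

Definition ideal_K : set (set baire) :=
  [set A | exists2 C : nat -> set baire,
    (forall n, compact (C n)) & A `<=` \bigcup_n C n].

Definition ideal_M : set (set baire) :=
  [set A | exists2 C : nat -> set baire,
    (forall n, (closure (C n))° = set0) & A `<=` \bigcup_n C n].

Definition cylinder (s : seq nat) : set baire :=
  [set x | mkseq x (size s) = s].

(* The standard measure on the Baire space is the product of countably many
   copies of the probability measure on nat giving {n} the mass 2^-(n+1). *)
Definition cylinder_measure (R : realType) (s : seq nat) : R :=
  \prod_(n <- s) 2^-1 ^+ n.+1.

Definition baire_outer_measure (R : realType) (A : set baire) : \bar R :=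
  ereal_inf [set (\sum_(0 <= i <oo) (cylinder_measure R (s i))%:E)%E
            | s in [set s : nat -> seq nat | A `<=` \bigcup_i cylinder (s i)]].

Definition ideal_N (R : realType) : set (set baire) :=
  [set A | baire_outer_measure R A = 0%E].

(* [is_add I k] is add(I) = k. *)
Definition is_add (I : set (set baire)) (k : cardinal) : Prop :=
  least_size [set F : set (set baire) | F `<=` I /\ ~ I (\bigcup_(A in F) A)] k.

(* Main.v *)
Require Import Defs.
From mathcomp Require Import all_boot all_order all_algebra.
From mathcomp Require Import finmap wochoice.
From mathcomp Require Import all_classical all_reals all_analysis.
Import Order.TTheory GRing.Theory Num.Theory.
Local Open Scope classical_set_scope.
Local Open Scope card_scope.

Set Implicit Arguments.
Unset Strict Implicit.
Unset Printing Implicit Defensive.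

(** The relations [R_I] and [<=*] on [c^c] are Tukey equivalent, so they have the
    same bounding and dominating numbers.  Call a set small if its size is below
    [c], and enumerate the Baire space as [x_a], [a < c].

    If [f (x_a) = x_(F a)] and [F <=* g], then off a small set [f (x_a)] lies in
    the small set [{x_b | b <= g a}], which is [R]-bounded as [b(R) = c]; small
    sets belong to [I] as [add(I) = c].

    Conversely, [I] has a base of size [c] and additivity [c], which yields [c]
    distinct points such that every set of [I] contains few of them.  Let [c] be
    the successor of [m], index these points by [c * m], and code [c^m] in [c].
    Given [h] in [c^c], at the point [(a, i)] take the value that the [i]-th of
    the [m] codes below [h a] assigns to [i].  If [g] is such that this function
    is [R_I]-below [g], pick for every [z] some [phi z] that is not [R]-below [z];
    then the function differs from [phi \o g] off a set of [I], so for all but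
    few [a] the code of [i |-> phi (g (a, i))] is not below [h a]. *)

(** * Cardinality *)

Lemma card_leTTP (T U : Type) :
  [set: T] #<= [set: U] <-> exists f : T -> U, injective f.
Proof.
split=> [/card_leP[f]|[f finj]].
  exists (fun x => val (f (SigSub (mem_set (I : [set: T] x))))) => x y /val_inj.
  by move=> /(@inj _ _ _ f); rewrite !in_setT => /(_ isT isT)[].
suff [g] : $|{injfun [set: T] >-> [set: U]}| by exact: inj_card_le.
by apply/injfunPex; exists f => // x y _ _; exact: finj.
Qed.

Lemma inj_card_leTT (T U : Type) (f : T -> U) :
  injective f -> [set: T] #<= [set: U].
Proof. by move=> finj; apply/card_leTTP; exists f. Qed.

Lemma set_inj_card_le (T U : Type) (A : set T) (B : set U) (f : T -> U) :
  set_fun A B f -> set_inj A f -> A #<= B.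
Proof.
move=> fAB finj; suff [g] : $|{injfun A >-> B}| by exact: inj_card_le.
by apply/injfunPex; exists f.
Qed.

Lemma inj_section (T U : Type) (f : T -> U) (t0 : T) :
  injective f -> {g : U -> T | cancel f g}.
Proof.
move=> finj; have /choice[g gP] : forall u, exists t, forall x, f x = u -> x = t.
  move=> u; have [[x fx]|nx] := pselect (exists x, f x = u).
    by exists x => y; rewrite -fx => /finj.
  by exists t0 => y fy; case: nx; exists y.
by exists g => x; symmetry; exact: gP.
Qed.

(* A maximal set of points of the product any two of which differ in every
   coordinate projects onto some factor. *)
Lemma exists_least_card (J : Type) (A : J -> Type) (j0 : J) :
  exists j, forall i, [set: A j] #<= [set: A i].
Proof.
pose P (M : set (forall j, A j)) :=
  forall x y, M x -> M y -> forall j, x j = y j -> x = y.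
have [F FP Ftot|M [PM Mmax]] := @Zorn_bigcup _ P.
  move=> x y [X FX Xx] [Y FY Yy] j xyj.
  by case: (Ftot _ _ FX FY) => s; [apply: (FP _ FY) xyj|apply: (FP _ FX) xyj];
    rewrite //; exact: s.
have [j jsurj] : exists j, forall a : A j, exists2 x, M x & x j = a.
  apply: contrapT => /forallNP nsurj.
  have zP j : exists a : A j, forall x, M x -> x j <> a.
    have /existsNP[a na] := nsurj j; exists a => x Mx xja.
    by apply: na; exists x.
  pose z j := sval (cid (zP j)).
  have zM x j : M x -> x j <> z j by exact: (svalP (cid (zP j))).
  apply: (Mmax (z |` M)).
    split=> [x|/(_ z (or_introl erefl)) Mz]; first by right.
    exact: (zM z j0).
  move=> x y [->|Mx] [->|My] // j xyj; last exact: PM xyj.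
  - by case: (zM _ _ My (esym xyj)).
  - by case: (zM _ _ Mx xyj).
exists j => i; have sP a := cid2 (jsurj a).
apply: (@inj_card_leTT _ _ (fun a => s2val (sP a) i)) => a b /PM ab.
have {}ab := ab (s2valP (sP a)) (s2valP (sP b)).
by rewrite -(s2valP' (sP a)) ab (s2valP' (sP b)).
Qed.

Lemma card_leTT_total (T U : Type) :
  [set: T] #<= [set: U] \/ [set: U] #<= [set: T].
Proof.
have [[] h] := exists_least_card (fun b : bool => if b then T else U) true.
  by left; exact: (h false).
by right; exact: (h true).
Qed.

Section WellOrder.
Variables (T : Type) (R : rel T).
Hypothesis woR : well_order R.

Lemma wo_min (P : set T) :
  (exists x, P x) -> exists2 z, P z & forall x, P x -> R z x.
Proof.
move=> [x Px]; have [|z [[/asboolP zP zl] _]] := woR (A := [pred x | `[<P x>]]).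
  by exists x; exact/asboolP.
by exists z => // y Py; apply: zl; exact/asboolP.
Qed.

Lemma wo_total x y : R x y \/ R y x.
Proof.
have [|z [->|->] h] := @wo_min [set x; y]; first by exists x; left.
- by left; apply: h; right.
- by right; apply: h; left.
Qed.

Lemma wo_refl x : R x x.
Proof. by case: (wo_total x x). Qed.

(** Both [x] and [y] would be minima of the pair, and [well_order] makes minima unique. *)
Lemma wo_anti x y : R x y -> R y x -> x = y.
Proof.
move=> xy yx; have [|z [_ zu]] := woR (A := [pred u | `[<u = x \/ u = y>]]).
  by exists x; apply/asboolP; left.
have zE w : w = x \/ w = y -> R w x -> R w y -> z = w.
  by move=> ww wx wy; apply: zu; split=> [|u /asboolP[]->//]; exact/asboolP.
rewrite -(zE x) ?(zE y) ?wo_refl//; first by right.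
by left.
Qed.

Lemma wo_trans x y z : R x y -> R y z -> R x z.
Proof.
move=> xy yz.
have [|u uP h] := @wo_min [set u | u = x \/ u = y \/ u = z].
  by exists x; left.
have [hx hy hz] : [/\ R u x, R u y & R u z] by split; apply: h => /=; tauto.
case: uP => [<-//|[uy|uz]].
  by rewrite (_ : x = y)//; apply: wo_anti => //; rewrite -uy.
by rewrite (_ : y = z) in xy => //; apply: wo_anti => //; rewrite -uz.
Qed.

End WellOrder.

(** If [T] embeds into a proper initial segment of a well-order of [T], cut at the least such [a]:
    by minimality the segment below [a] embeds into none of its own proper segments. *)
Lemma exists_cardinal (T : Type) : exists k : cardinal, [set: k] #= [set: T].
Proof.
have [R woR] := @well_ordering_principle {classic T}.
have [big|nbig] := pselect (exists a, [set: T] #<= [set x | ~~ R a x]); last first.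
  have ini a : ~ ([set: {classic T}] #<= [set x | ~~ R a x]).
    by move=> h; apply: nbig; exists a.
  by exists (Cardinal woR ini); exact: card_eqxx.
have [a aT amin] := wo_min woR big.
pose S := {x | ~~ R a x}.
pose RS : rel S := fun x y => R (sval x) (sval y).
have woS : well_order RS.
  apply: antisymmetric_well_order.
    by move=> x y /andP[xy yx]; apply: val_inj; apply: (wo_anti woR).
  move=> A [x Ax].
  have [|z [y Ay <-] h] := @wo_min _ _ woR [set sval y | y in [set y | y \in A]].
    by exists (sval x); exists x.
  by exists y; split=> // u Au; apply: h; exists u.
have Sset : [set: S] #= [set x | ~~ R a x].
  rewrite card_eq_le; apply/andP; split.
    apply: (@set_inj_card_le _ _ _ _ (@sval _ _)) => [x _|x y _ _ /val_inj//].
    exact: (svalP x).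
  rewrite (card_le_eql (card_setT_sym _)).
  apply: (@inj_card_leTT _ _ (fun x => exist _ (val x) (set_mem (valP x)))).
  by move=> x y [] /val_inj.
have ini b : ~ ([set: S] #<= [set x | ~~ RS b x]).
  move=> h; have/negP := svalP b; apply; apply: amin.
  apply: card_le_trans aT _; rewrite -(card_le_eql Sset).
  apply: card_le_trans h _.
  by apply: (@set_inj_card_le _ _ _ _ (@sval _ _)) => [x //|x y _ _ /val_inj].
exists (Cardinal woS ini); rewrite card_eq_le /=.
by rewrite (card_le_eql Sset) (card_le_eqr Sset) card_leT aT.
Qed.

(** A member of [P] of least size exists by [exists_least_card]; the two-way comparison makes its
    size least for [Q] too. *)
Lemma least_size_same (T U : Type) (P : set (set T)) (Q : set (set U)) :
  (exists A, P A) ->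
  (forall A, P A -> exists2 B, Q B & B #<= A) ->
  (forall B, Q B -> exists2 A, P A & A #<= B) ->
  exists k, least_size P k /\ least_size Q k.
Proof.
move=> [A0 PA0] PQ QP.
have [[A PA] Amin] :=
  exists_least_card (fun A : {A | P A} => set_type (sval A)) (exist _ A0 PA0).
have {}Amin A' : P A' -> A #<= A'.
  by move=> PA'; have := Amin (exist _ A' PA'); rewrite /= -(card_le_eql (card_setT_sym _))
    -(card_le_eqr (card_setT_sym _)).
have [k kA] := exists_cardinal A; have {}kA := card_eq_trans kA (card_setT A).
exists k; split; split.
- by exists A => //; rewrite card_eq_sym.
- by move=> A' PA'; rewrite (card_le_eql kA) Amin.
- have [B QB BA] := PQ _ PA; exists B => //.
  rewrite card_eq_le (card_le_eqr kA) (card_le_eql kA) BA /=.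
  by have [A' PA' A'B] := QP _ QB; apply: card_le_trans A'B; exact: Amin.
- move=> B QB; rewrite (card_le_eql kA).
  by have [A' PA' A'B] := QP _ QB; apply: card_le_trans A'B; exact: Amin.
Qed.

Lemma succ_small_le (m k : cardinal) (T : Type) (A : set T) :
  is_succ_of m k -> ~ ([set: k] #<= A) -> A #<= [set: m].
Proof.
move=> [_ ksucc] smallA; have [l lA] := exists_cardinal A.
have {}lA := card_eq_trans lA (card_setT A).
by rewrite -(card_le_eql lA); apply: contrapT => /ksucc; rewrite (card_le_eqr lA).
Qed.

(** * Sets of the size of the continuum *)

Lemma card_seq_continuum : [set: nat -> nat -> bool] #<= [set: nat -> bool].
Proof.
apply: (@inj_card_leTT _ _ (fun (u : nat -> nat -> bool) n =>
  if (choice.unpickle n : option (nat * nat)) is Some (i, j) then u i j else false)) => u v uv.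
apply/funext => i; apply/funext => j.
by have := congr1 (@^~ (choice.pickle (i, j))) uv; rewrite /= choice.pickleK.
Qed.

Lemma card_continuum_pow (T : countType) :
  [set: T -> nat -> bool] #<= [set: nat -> bool].
Proof.
apply: card_le_trans card_seq_continuum.
apply: (@inj_card_leTT _ _ (fun (u : T -> nat -> bool) n =>
  if choice.unpickle n is Some t then u t else fun=> false)) => u v uv.
by apply/funext => t; have := congr1 (@^~ (choice.pickle t)) uv; rewrite choice.pickleK.
Qed.

Lemma card_continuum_prod :
  [set: (nat -> bool) * (nat -> bool)] #<= [set: nat -> bool].
Proof.
apply: card_le_trans (card_continuum_pow bool).
apply: (@inj_card_leTT _ _ (fun u b => if b then u.1 else u.2)) => -[u1 u2] [v1 v2].
by move=> uv; congr (_, _); [exact: (congr1 (@^~ true) uv)|exact: (congr1 (@^~ false) uv)].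
Qed.

Lemma card_countType_fun (S T : countType) :
  [set: S -> T] #<= [set: nat -> bool].
Proof.
apply: card_le_trans (card_continuum_pow S).
apply: (@inj_card_leTT _ _ (fun x n m => m == choice.pickle (x n))) => x y xy.
apply/funext => n; apply: (pcan_inj (@choice.pickleK _)); apply/eqP.
by have := congr1 (fun f => f n (choice.pickle (x n))) xy; rewrite eqxx => <-.
Qed.

Lemma card_countType_fun2 (S S' T : countType) :
  [set: S -> S' -> T] #<= [set: nat -> bool].
Proof.
apply: card_le_trans (card_countType_fun (S * S')%type T).
apply: (@inj_card_leTT _ _ (fun u (st : S * _) => u st.1 st.2)) => u v uv.
by apply/funext => s; apply/funext => t; exact: (congr1 (@^~ (s, t)) uv).
Qed.

Lemma card_fun_le (S S' T T' : Type) :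
  [set: S] #<= [set: S'] -> [set: T] #<= [set: T'] -> T ->
  [set: S -> T] #<= [set: S' -> T'].
Proof.
move=> /card_leTTP[f finj] /card_leTTP[g ginj] t.
have [[s _]|nS] := pselect (exists s : S, True); last first.
  apply: (@inj_card_leTT _ _ (fun _ _ => g t)) => u v _.
  by apply/funext => s; case: nS; exists s.
have [f' fK] := inj_section s finj.
apply: (@inj_card_leTT _ _ (fun u s' => g (u (f' s')))) => u v uv.
apply/funext => s'; apply: ginj.
by have := congr1 (@^~ (f s')) uv; rewrite fK.
Qed.

Lemma card_prod_le (S S' T T' : Type) :
  [set: S] #<= [set: S'] -> [set: T] #<= [set: T'] ->
  [set: S * T] #<= [set: S' * T'].
Proof.
move=> /card_leTTP[f finj] /card_leTTP[g ginj].
apply: (@inj_card_leTT _ _ (fun st : S * T => (f st.1, g st.2))) => -[s t] [s' t'] /=.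
by case=> /finj -> /ginj ->.
Qed.

(* A continuum remains one when a point is removed, so it cannot have a
   largest element. *)
Lemma continuum_segment_small (k : cardinal) (a : k) :
  is_continuum k -> ~ ([set: k] #<= [set c | cle c a]).
Proof.
move=> kc kle.
have [[b ab]|amax] := pselect (exists b, clt a b).
  apply: (@cle_initial k b); apply: card_le_trans kle _.
  apply: subset_card_le => c /= ca; apply: contra ab => bc.
  exact: (wo_trans (@cle_wo k) bc ca).
apply: (@cle_initial k a).
move: (kc); rewrite /is_continuum card_eq_le => /andP[/card_leTTP[f finj] /card_leTTP[g ginj]].
(* [h] below codes [x] after a bit opposite to the first bit of [t], so it misses the largest
   element [a]. *)
have [t gt] : exists t, forall u, g u = a -> u = t.
  have [[t gt]|nt] := pselect (exists t, g t = a).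
    by exists t => u; rewrite -gt => /ginj.
  by exists (fun=> true) => u gu; case: nt; exists u.
pose h (x : k) := g (fun n => if n is n'.+1 then f x n' else ~~ t 0%N).
apply: (@set_inj_card_le _ _ _ _ h) => [x _|x y _ _ /ginj xy]; last first.
  by apply: finj; apply/funext => n; have := congr1 (@^~ n.+1) xy.
apply/negP => ahx; have /gt ht : h x = a.
  apply: (wo_anti (@cle_wo k) _ ahx).
  by apply: contrapT => /negP ha; apply: amax; exists (h x).
by have := congr1 (@^~ 0%N) ht; case: (t 0%N).
Qed.

(** * Tukey reductions *)

Definition tukey (X Y X' Y' : Type) (R : X -> Y -> Prop) (S : X' -> Y' -> Prop) :=
  exists (phi : X -> X') (psi : Y' -> Y),
    forall x y', S (phi x) y' -> R x (psi y').

(** [phi] maps unbounded families to unbounded ones and [psi] maps dominating families back, neither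
    increasing the size. The last two hypotheses make such families exist. *)
Lemma tukey_same_b_d (X Y X' Y' : Type) (R : X -> Y -> Prop)
    (S : X' -> Y' -> Prop) :
  tukey R S -> tukey S R -> unbounded R setT -> dominating R setT ->
  (exists k, is_b R k /\ is_b S k) /\ (exists k, is_d R k /\ is_d S k).
Proof.
have ub (X1 Y1 X2 Y2 : Type) (R1 : X1 -> Y1 -> Prop) (R2 : X2 -> Y2 -> Prop) :
    tukey R1 R2 -> forall A, unbounded R1 A -> exists2 B, unbounded R2 B & B #<= A.
  move=> [phi [psi RS]] A uA; exists (phi @` A); last exact: card_image_le.
  by move=> [y yP]; apply: uA; exists (psi y) => x Ax; apply/RS/yP; exists x.
have dom (X1 Y1 X2 Y2 : Type) (R1 : X1 -> Y1 -> Prop) (R2 : X2 -> Y2 -> Prop) :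
    tukey R1 R2 -> forall D, dominating R2 D -> exists2 B, dominating R1 B & B #<= D.
  move=> [phi [psi RS]] D dD; exists (psi @` D); last exact: card_image_le.
  by move=> x; have [y Dy xy] := dD (phi x); exists (psi y); [exists y|exact: RS].
move=> RS SR uR dR; split; apply: least_size_same;
  [by exists setT|exact: ub RS|exact: ub SR|by exists setT|exact: dom SR|exact: dom RS].
Qed.

Record ideal_with_base (I : set (set baire)) : Prop := IdealWithBase {
  ideal_sub : forall A B, A `<=` B -> I B -> I A;
  ideal_singleton : forall x, I [set x];
  ideal_base : exists B : (nat -> bool) -> set baire,
    (forall u, I (B u)) /\ forall X, I X -> exists u, X `<=` B u }.

(** * Tukey equivalence of [R_I] and [<=*] on [k^k] *)

Section LiftedRelation.
(** [m] stands for a predecessor of [k]; both halves of the theorem are instances of these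
    hypotheses. *)
Variables (k : cardinal) (m : Type) (R : baire_rel) (I : set (set baire)).
Local Notation small A := (~ ([set: k] #<= A)).
Hypothesis k_continuum : is_continuum k.
Hypothesis small_le : forall (T : Type) (A : set T), small A -> A #<= [set: m].
Hypothesis card_pow : [set: m -> k] #<= [set: k].
Hypothesis card_prod : [set: k * m] #<= [set: k].
Hypothesis R_small_bounded : forall A, small A -> exists z, forall x, A x -> R x z.
Hypothesis R_unbounded : unbounded R setT.
Hypothesis I_ideal : ideal_with_base I.
Hypothesis I_small_union : forall F : set (set baire),
  small F -> F `<=` I -> I (\bigcup_(A in F) A).
Hypothesis I_proper : ~ I setT.

Let cle_refl := wo_refl (@cle_wo k).

Lemma small_card_le (T U : Type) (A : set T) (B : set U) :
  A #<= B -> small B -> small A.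
Proof. by move=> AB sB kA; apply: sB; exact: card_le_trans kA AB. Qed.

Lemma baire_enum : exists (idx : baire -> k) (pt : k -> baire), cancel idx pt.
Proof.
have : [set: baire] #<= [set: k].
  by rewrite (card_le_eqr k_continuum); exact: card_countType_fun.
move=> /card_leTTP[idx inj_idx].
by have [pt idxK] := inj_section (fun=> 0%N) inj_idx; exists idx, pt.
Qed.

Lemma small_ideal (A : set baire) : small A -> I A.
Proof.
move=> sA; apply: (ideal_sub I_ideal) (I_small_union (F := set1 @` A) _ _).
- by move=> x Ax; exists [set x] => //; exists x.
- exact: small_card_le (card_image_le _ _) sA.
- by move=> _ [x _ <-]; exact: ideal_singleton.
Qed.

Lemma tukey_lift_cle_star : tukey (@lift_rel R I) (@cle_star k).
Proof.
have [idx [pt idxK]] := baire_enum.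
(* [bd a] bounds all points of index at most [a]; they are few, as segments of [k] are small. *)
have /choice[bd bdP] : forall a, exists z, forall c, cle c a -> R (pt c) z.
  move=> a; have [|z zP] := R_small_bounded (A := pt @` [set c | cle c a]).
    exact: small_card_le (card_image_le _ _) (@continuum_segment_small k _ k_continuum).
  by exists z => c ca; apply: zP; exists c.
exists (fun f a => idx (f (pt a))), (fun g x => bd (g (idx x))) => f g [b bP].
(* The points where the relation fails have index below [b]. *)
apply: small_ideal.
apply: (small_card_le (B := [set a | clt a b])); last exact: cle_initial.
apply: (@set_inj_card_le _ _ _ _ idx) => [x /= nR|x y _ _]; last exact: can_inj idxK x y.
apply: bP; rewrite idxK; apply/negP => le; apply: nR.
by rewrite -[f x]idxK; exact: bdP.
Qed.

(** [r x] is the least index of a base set containing [x]. For a small [A], the base sets with index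
    at most some member of [A] have their union in the ideal, and a point outside it outranks [A].
    So small subsets of [k] are bounded, which later serves as regularity of [k]. *)
Lemma ideal_rank : exists r : baire -> k,
  (forall X, I X -> exists b, forall x, X x -> cle (r x) b) /\
  (forall A : set k, small A -> exists x, forall a, A a -> clt a (r x)).
Proof.
have [B0 [IB0 B0max]] := ideal_base I_ideal.
have [B [IB Bmax]] : exists B : k -> set baire,
    (forall a, I (B a)) /\ forall X, I X -> exists a, X `<=` B a.
  have [g ginj] : exists g : (nat -> bool) -> k, injective g.
    by apply/card_leTTP; rewrite (card_le_eqr k_continuum).
  have [g' gK] := inj_section (fun=> true) ginj.
  exists (B0 \o g'); split=> [a|X /B0max[u Xu]]; first exact: IB0.
  by exists (g u); rewrite /= gK.
have /choice[r rP] : forall x, exists a, B a x /\ forall b, B b x -> cle a b.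
  move=> x; have [a xa] := Bmax _ (ideal_singleton I_ideal x).
  have [|b Bb bmin] := @wo_min _ _ (@cle_wo k) [set a | B a x].
    by exists a; exact: xa.
  by exists b.
exists r; split=> [X /Bmax[b Xb]|A sA].
  by exists b => x /Xb; exact: (rP x).2.
pose N a := \bigcup_(b in [set b | cle b a]) B b.
have IN a : I (N a).
  rewrite /N -(bigcup_image _ B id); apply: I_small_union.
    exact: small_card_le (card_image_le _ _) (@continuum_segment_small k _ k_continuum).
  by move=> _ [b _ <-].
have [x nx] : exists x, ~ (\bigcup_(a in A) N a) x.
  apply: contrapT => /forallNP allx; apply: I_proper.
  rewrite (_ : setT = \bigcup_(a in A) N a); last first.
    by apply/seteqP; split=> x // _; apply: contrapT; exact: allx.
  rewrite -(bigcup_image _ N id); apply: I_small_union => [|_ [a _ <-]//].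
  exact: small_card_le (card_image_le _ _) sA.
exists x => a Aa; apply/negP => ra; apply: nx; exists a => //.
by exists (r x) => //; exact: (rP x).1.
Qed.

(** The points are chosen with distinct ranks. There are [k] ranks, since a small range would lie
    strictly below some [r x]; a set in the ideal has bounded rank and so contains few of the
    points. *)
Lemma ideal_points : exists p : k -> baire,
  injective p /\ forall X, I X -> small (p @^-1` X).
Proof.
have [r [rI runb]] := ideal_rank.
have : [set: k] #<= range r.
  apply: contrapT => /runb[x /(_ (r x) (imageT r x))].
  by rewrite /clt cle_refl.
rewrite (card_le_eqr (card_setT_sym _)) => /card_leTTP[q qinj].
have /choice[s sP] : forall a : range r, exists x, r x = val a.
  by move=> a; have [x _ xa] := set_mem (valP a); exists x.
exists (s \o q); split=> [a b /(congr1 r)|X /rI[b Xb]].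
  by rewrite /= !sP => /val_inj/qinj.
apply: small_card_le (@continuum_segment_small k b k_continuum).
apply: (@set_inj_card_le _ _ _ _ (val \o q)) => [a /= Xa|x y _ _ /val_inj/qinj//].
by rewrite -sP; exact: Xb.
Qed.

(* The point [q (xi, i)] guesses that the block [fun j => phi (g (q (xi, j)))] is
   coded by the [i]-th predecessor of [h xi]; the guess is tested at [j = i]. *)
Lemma tukey_cle_star_lift : tukey (@cle_star k) (@lift_rel R I).
Proof.
have [idx [pt idxK]] := baire_enum.
have [p [pinj pI]] := ideal_points.
have [pair pairinj] : exists pair : k * m -> k, injective pair by exact/card_leTTP.
have a0 : k := idx (fun=> 0%N).
have [code codeinj] : exists code : (m -> k) -> k, injective code by exact/card_leTTP.
have [decode codeK] := inj_section (fun=> a0) codeinj.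
(* The predecessors of [b] are few, so indices from [m] suffice to list them by [e b]. *)
have /choice[e eP] : forall b, exists e : m -> k, forall c, clt c b -> exists i, e i = c.
  move=> b; pose C := [set c : k | clt c b].
  have : C #<= [set: m] by apply: small_le; exact: cle_initial.
  rewrite (card_le_eql (card_setT_sym _)) => /card_leTTP[f finj].
  have [[c0 _]|nc] := pselect (exists c : C, True); last first.
    by exists (fun=> a0) => c cb; case: nc; exists (SigSub (mem_set (cb : C c))).
  have [f' fK] := inj_section c0 finj.
  by exists (val \o f') => c cb; exists (f (SigSub (mem_set (cb : C c)))); rewrite /= fK.
have /choice[phi phiP] : forall z, exists x, ~ R x z.
  by move=> z; apply: contrapT => /forallNP zP; apply: R_unbounded;
    exists z => x _; exact: contrapT.
pose q xi := p (pair xi).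
have qinj : injective q by move=> x y /pinj/pairinj.
(* An empty [k * m] forces [m] to be empty; then no element has a predecessor and [<=*] always
   holds. *)
have [[xi0 _]|nq] := pselect (exists xi : k * m, True); last first.
  exists (fun _ _ => fun=> 0%N), (fun _ => id) => h g _; exists a0 => a.
  by move=> /eP[i _]; case: nq; exists (a, i).
have [q' qK] := inj_section xi0 qinj.
exists (fun h x => pt (decode (e (h (q' x).1) (q' x).2) (q' x).2)),
  (fun g xi => code (fun i => idx (phi (g (q (xi, i)))))) => h g /pI.
set X := preimage _ _ => sX.
have [r [_ runb]] := ideal_rank.
(* [X'] collects the blocks that meet the exceptional set. Picking one point in each embeds [X']
   into the small [X], so [X'] is bounded. *)
pose X' := [set a | exists i, X (pair (a, i))].
have /choice[i iP] : forall a, exists i, X' a -> X (pair (a, i)).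
  move=> a; have [[i Xi]|nX] := pselect (X' a); first by exists i.
  by exists xi0.2.
have /runb[x xP] : small X'.
  apply: small_card_le sX; apply: (@set_inj_card_le _ _ _ _ (fun a => pair (a, i a))).
    by move=> a; exact: iP.
  by move=> a b _ _ /pairinj[].
exists (r x) => a gh; apply: xP.
(* A code below [h a] is listed as some [e (h a) j]; at [q (a, j)] the guess then returns
   [phi (g (q (a, j)))], which fails the relation, so [a] lies in [X']. *)
have [j ej] := eP _ _ gh; exists j; rewrite /X /preimage /= -/(q (a, j)) qK /= ej codeK idxK.
exact: phiP.
Qed.

Lemma lift_rel_b_d :
  (exists l, is_b (@lift_rel R I) l /\ is_b (@cle_star k) l) /\
  (exists l, is_d (@lift_rel R I) l /\ is_d (@cle_star k) l).
Proof.
have [idx _] := baire_enum; have a0 : k := idx (fun=> 0%N).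
apply: tukey_same_b_d.
- exact: tukey_lift_cle_star.
- exact: tukey_cle_star_lift.
- move=> [g gP].
  have /choice[f fP] : forall x, exists y, ~ R y (g x).
    by move=> x; apply: contrapT => /forallNP zP; apply: R_unbounded;
      exists (g x) => y _; exact: contrapT.
  by apply: I_proper; apply: (ideal_sub I_ideal) (gP f Logic.I); move=> x _; exact: fP.
- move=> f; have [phi [psi fg]] := tukey_lift_cle_star.
  exists (psi (phi f)) => //; apply: fg; exists a0 => a.
  by rewrite /clt cle_refl.
Qed.

End LiftedRelation.

(** * The ideals *)

(** [J] may index sets outside [I]; such indices are sent to the empty set. *)
Lemma ideal_base_of_card (I : set (set baire)) (J : Type) (B : J -> set baire) :
  [set: J] #<= [set: nat -> bool] -> I set0 ->
  (forall X, I X -> exists2 j, I (B j) & X `<=` B j) ->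
  exists B : (nat -> bool) -> set baire,
    (forall u, I (B u)) /\ forall X, I X -> exists u, X `<=` B u.
Proof.
move=> /card_leTTP[f finj] I0 Bmax; have [j0 _ _] := Bmax _ I0.
have [g fK] := inj_section j0 finj.
exists (fun u => if pselect (I (B (g u))) then B (g u) else set0).
split=> [u|X /Bmax[j IBj XB]]; first by case: pselect.
by exists (f j); rewrite fK; case: pselect.
Qed.

(** * Cylinders and the product topology *)

Lemma cylinder_mkseqP (x y : baire) (n : nat) :
  cylinder (mkseq x n) y <-> forall i, (i < n)%N -> y i = x i.
Proof.
rewrite /cylinder /= size_mkseq; split=> [yx i ni|yx].
  by rewrite -(nth_mkseq 0%N y ni) yx nth_mkseq.
by apply: (@eq_from_nth _ 0%N); rewrite !size_mkseq // => i ni; rewrite !nth_mkseq ?yx.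
Qed.

Lemma nbhs_baireP (x : baire) (A : set baire) :
  nbhs x A <-> exists n, cylinder (mkseq x n) `<=` A.
Proof.
split=> [|[n /filterS]]; last first.
  apply; elim: n => [|n IH]; first by apply: filterE => y; exact/cylinder_mkseqP.
  have xn : nbhs x [set y : baire | y n = x n].
    exact: (@proj_continuous nat (fun=> nat) n x [set x n]).
  apply: filterS (filterI IH xn) => y [/cylinder_mkseqP yx /= yn].
  by apply/cylinder_mkseqP => i; rewrite ltnS leq_eqVlt => /predU1P[->|/yx].
(* The cylinders around [x] generate a filter; it converges in each discrete coordinate, hence in
   the product topology. *)
pose F : set_system baire := [set A : set baire | exists n, cylinder (mkseq x n) `<=` A].
have FF : Filter F.
  split=> [|B C [n nB] [p pC]|B C BC [n nB]]; first by exists 0%N.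
    exists (maxn n p) => y /cylinder_mkseqP yx.
    by split; [apply: nB|apply: pC]; apply/cylinder_mkseqP => i ip; apply: yx;
      rewrite leq_max ip ?orbT.
  by exists n; exact: subset_trans BC.
suff : F --> x by apply.
apply/cvg_sup => N U [V] [[W] oW <-] WxN WU.
exists N.+1; apply: subset_trans WU => y /cylinder_mkseqP yx /=.
by rewrite yx.
Qed.

Lemma bigcup_of_bigcup (Q : set (set baire)) (F : nat -> set baire) :
  (forall n, exists2 C : nat -> set baire, (forall i, Q (C i)) & F n `<=` \bigcup_i C i) ->
  exists2 C : nat -> set baire,
    (forall i, Q (C i)) & \bigcup_n F n `<=` \bigcup_i C i.
Proof.
move=> QF; pose C n := s2val (cid2 (QF n)).
exists (fun j => let p := odflt (0, 0)%N (choice.unpickle j) in C p.1 p.2).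
  by move=> j; exact: (s2valP (cid2 (QF _))).
move=> x [n _ /(s2valP' (cid2 (QF n)))[i _ Cx]].
by exists (choice.pickle (n, i)) => //; rewrite choice.pickleK.
Qed.

(** * The sigma-compact ideal *)

Lemma compact_baire_bounded (C : set baire) :
  compact C -> exists y : baire, C `<=` [set x | forall n, (x n <= y n)%N].
Proof.
move=> /compact_near_coveringP cC.
have /choice[y yP] : forall n, exists b, forall x, C x -> (x n <= b)%N.
  (* Coordinate [n] is constant near each point, and the near-covering form of compactness makes the
     local bounds uniform. *)
  move=> n; suff [b _ bP] : \forall b \near \oo, C `<=` (fun x : baire => (x n <= b)%N).
    by exists b => x Cx; exact: (bP b (leqnn b)).
  apply: cC => x Cx.
  exists ([set y : baire | y n = x n], [set b | (x n <= b)%N]) => /=.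
    split; first exact: (@proj_continuous nat (fun=> nat) n x [set x n]).
    by exists (x n).
  by move=> [y b] [/= -> ].
by exists y => x Cx n; exact: yP.
Qed.

Lemma ideal_K_with_base : ideal_with_base ideal_K.
Proof.
split=> [A B AB [C cC BC]|x|].
- by exists C => //; exact: subset_trans BC.
- by exists (fun=> [set x]) => [_|y ->]; [exact: compact_set1|exists 0%N].
(* The base consists of countable unions of boxes, which are compact by Tychonoff since their
   factors are finite. *)
- apply: (@ideal_base_of_card _ (nat -> nat -> nat)
    (fun y => \bigcup_j [set x : baire | forall n, (x n <= y j n)%N])).
  + exact: card_countType_fun2.
  + by exists (fun=> set0) => // _; exact: compact0.
  + move=> X [C cC XC]; have /choice[y yP] := fun j => compact_baire_bounded (cC j).
    exists y; last by move=> x /XC[j _ /yP xy]; exists j.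
    exists (fun j => [set x | forall n, (x n <= y j n)%N]) => // j.
    apply: (@tychonoff nat (fun=> nat) (fun n => [set i | (i <= y j n)%N])) => n.
    by apply: finite_compact; apply: (sub_finite_set _ (finite_II (y j n).+1)).
Qed.

Lemma ideal_K_bigcup (F : nat -> set baire) :
  (forall n, ideal_K (F n)) -> ideal_K (\bigcup_n F n).
Proof. exact: bigcup_of_bigcup. Qed.

Lemma ideal_K_proper : ~ ideal_K setT.
Proof.
move=> [C cC CT]; have /choice[y yP] := fun j => compact_baire_bounded (cC j).
have [j _ /yP/(_ j)] := CT (fun n => (y n n).+1) I.
by rewrite ltnn.
Qed.

(** * The meager ideal *)

Lemma nowhere_denseP (C : set baire) : (closure C)° = set0 <->
  forall (x : baire) n, exists (y : baire) p,
    [/\ (n < p)%N, cylinder (mkseq x n) y & cylinder (mkseq y p) `&` C = set0].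
Proof.
split=> [C0 x n|CP].
  have : ~ cylinder (mkseq x n) `<=` closure C.
    move=> xC; suff : (closure C)° x by rewrite C0.
    by apply/nbhs_baireP; exists n.
  move=> /existsNP[y /not_implyP[yx /existsNP[V /not_implyP[/nbhs_baireP[p pV] VC]]]].
  (* The length is forced above [n], so that iterated choices determine a point. *)
  exists y, (maxn n.+1 p); split=> //; first by rewrite leq_max ltnSn.
  apply/seteqP; split=> // z [/cylinder_mkseqP zy Cz]; apply: VC; exists z; split=> //.
  by apply: pV; apply/cylinder_mkseqP => i ip; apply: zy; rewrite leq_max ip orbT.
apply/seteqP; split=> // x /nbhs_baireP[n nC].
have [y [p [_ /nC yC pC]]] := CP x n.
have /yC[z] : nbhs y (cylinder (mkseq y p)) by apply/nbhs_baireP; exists p.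
by rewrite setIC pC.
Qed.

Lemma ideal_M_with_base : ideal_with_base ideal_M.
Proof.
split=> [A B AB [C cC BC]|x|].
- by exists C => //; exact: subset_trans BC.
- exists (fun=> [set x]) => [_|y ->]; last by exists 0%N.
  apply/nowhere_denseP => y n.
  exists (fun i => if i == n then (x n).+1 else y i), n.+1; split=> //.
    by apply/cylinder_mkseqP => i; case: eqP => // ->; rewrite ltnn.
  apply/seteqP; split=> // z [/cylinder_mkseqP zy zx].
  by have := zy n (ltnSn n); rewrite zx eqxx => /n_Sn.
(* [U j] selects cylinders to remove; removing all those disjoint from [C j] leaves its closure,
   still nowhere dense. *)
- apply: (@ideal_base_of_card _ (nat -> seq nat -> bool)
    (fun U => \bigcup_j [set x | forall s, U j s -> ~ cylinder s x])).
  + exact: card_countType_fun2.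
  + exists (fun=> set0) => // _.
    apply/nowhere_denseP => x n; exists x, n.+1; rewrite setI0; split=> //.
    by
      exact/cylinder_mkseqP.
  + move=> X [C cC XC]; exists (fun j s => `[< cylinder s `&` C j = set0 >]); last first.
      move=> x /XC[j _ Cx]; exists j => // s /asboolP sC sx.
      by have : (cylinder s `&` C j) x by []; rewrite sC.
    exists (fun j => [set x | forall s,
      `[< cylinder s `&` C j = set0 >] -> ~ cylinder s x]) => // j; apply/nowhere_denseP => x n.
    have [y [p [np yx yC]]] := (nowhere_denseP (C j)).1 (cC j) x n.
    exists y, p; split=> //; apply/seteqP; split=> // z [zy /(_ (mkseq y p))].
    by case=> //; exact/asboolP.
Qed.

Lemma ideal_M_bigcup (F : nat -> set baire) :
  (forall n, ideal_M (F n)) -> ideal_M (\bigcup_n F n).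
Proof. exact: (@bigcup_of_bigcup [set C | (closure C)° = set0]). Qed.

(** Baire category: [t] is a shrinking sequence of cylinders, stage [j + 1] missing [C j], and [x]
    is their common point. *)
Lemma ideal_M_proper : ~ ideal_M setT.
Proof.
move=> [C cC CT].
have /choice[next nextP] : forall jxn : nat * (baire * nat), exists yp : baire * nat,
    [/\ (jxn.2.2 < yp.2)%N, cylinder (mkseq jxn.2.1 jxn.2.2) yp.1 &
        cylinder (mkseq yp.1 yp.2) `&` C jxn.1 = set0].
  move=> [j [x n]]; have [y [p yp]] := (nowhere_denseP (C j)).1 (cC j) x n.
  by exists (y, p).
pose t := fix t j := if j is j'.+1 then next (j', t j') else ((fun=> 0%N) : baire, 0%N).
have tP j : [/\ ((t j).2 < (t j.+1).2)%N,
    forall i, (i < (t j).2)%N -> (t j.+1).1 i = (t j).1 i &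
    cylinder (mkseq (t j.+1).1 (t j.+1).2) `&` C j = set0].
  by have [? /cylinder_mkseqP ? ?] := nextP (j, t j).
have tge j : (j <= (t j).2)%N.
  by elim: j => // j IH; have [lt _ _] := tP j; exact: leq_ltn_trans IH lt.
have agree j d i : (i < (t j).2)%N -> (t (j + d)%N).1 i = (t j).1 i /\ (i < (t (j + d)%N).2)%N.
  move=> ij; elim: d => [|d [IH lt]]; first by rewrite addn0.
  have [lt' eq _] := tP (j + d)%N; rewrite addnS eq //; split=> //.
  exact: ltn_trans lt lt'.
(* Stage [i + 1] has length above [i], so its coordinate [i] is already final. *)
pose x : baire := fun i => (t i.+1).1 i.
have xP j i : (i < (t j).2)%N -> x i = (t j).1 i.
  move=> ij; rewrite /x; have [le|lt] := leqP j i.+1.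
    by rewrite -(subnKC le); exact: (agree _ _ _ ij).1.
  by rewrite -(subnKC (ltnW lt)); symmetry; apply: (agree _ _ _ _).1; exact: tge.
have [j _ Cx] := CT x I; have [_ _] := tP j.
move=> /seteqP[/(_ x) + _]; apply; split=> //.
by apply/cylinder_mkseqP => i; exact: xP.
Qed.

(** * The null ideal *)

Section NullIdeal.
Variable K : realType.
Local Open Scope ring_scope.
Local Notation mu := (cylinder_measure K).

Lemma cylinder_measure_ge0 s : 0 <= mu s.
Proof. by apply: prodr_ge0 => i _; rewrite exprn_ge0// invr_ge0. Qed.

Lemma cylinder_measure_cons n s : mu (n :: s) = 2^-1 ^+ n.+1 * mu s.
Proof. exact: big_cons. Qed.

Lemma cylinder_measure_le s : mu s <= 2^-1 ^+ size s.
Proof.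
elim: s => [|n s IH]; first by rewrite /cylinder_measure big_nil.
rewrite cylinder_measure_cons [size _]/= [leRHS]exprS.
rewrite ler_pM ?cylinder_measure_ge0 ?exprn_ge0 ?invr_ge0//.
rewrite exprS ler_piMr ?invr_ge0//.
by rewrite exprn_ile1 ?invr_ge0// invf_le1 ?ler1n.
Qed.

Lemma half_power_lt (e : K) : 0 < e -> exists n, 2^-1 ^+ n <= e.
Proof.
move=> e0; exists (Num.truncn e^-1).+1.
rewrite exprVn invf_ple ?posrE ?exprn_gt0//.
apply: (le_trans (ltW (truncnS_gt _))); rewrite -natrX ler_nat.
exact: ltnW (ltn_expl _ _).
Qed.

Lemma ideal_NP (X : set baire) : ideal_N K X <->
  forall e : K, 0 < e -> exists2 s : nat -> seq nat, X `<=` \bigcup_i cylinder (s i) &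
    (\sum_(0 <= i <oo) (mu (s i))%:E <= e%:E)%E.
Proof.
split=> [X0 e e0|XP].
  have : (baire_outer_measure K X < e%:E)%E by rewrite X0 lte_fin.
  by move=> /ereal_inf_lt[_ [s Xs <-] /ltW se]; exists s.
apply/eqP; rewrite eq_le; apply/andP; split; last first.
  apply: le_ereal_inf_tmp => _ [s _ <-]; apply: nneseries_ge0 => i _ _.
  by rewrite lee_fin cylinder_measure_ge0.
apply/lee_addgt0Pr => e e0; rewrite add0e; have [s Xs se] := XP e e0.
by apply: le_trans se; apply: ereal_inf_lbound; exists s.
Qed.

Lemma ideal_N_with_base : ideal_with_base (ideal_N K).
Proof.
have sub A B : A `<=` B -> ideal_N K B -> ideal_N K A.
  move=> AB /ideal_NP BP; apply/ideal_NP => e /BP[s Bs se].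
  by exists s => //; exact: subset_trans Bs.
have sing x : ideal_N K [set x].
  apply/ideal_NP => e e0.
  (* A cover is an infinite sequence and every cylinder has positive measure, so the lengths must
     grow to keep the sum at most [e]. *)
  have /choice[n nP] : forall i, exists n, 2^-1 ^+ n <= e / (2 ^ i.+1)%:R.
    by move=> i; apply: half_power_lt; rewrite divr_gt0// ltr0n expn_gt0.
  exists (fun i => mkseq x (n i)).
    by move=> y ->; exists 0%N => //; exact/cylinder_mkseqP.
  apply: le_trans (epsilon_trick0 xpredT (ltW e0)).
  apply: lee_nneseries => i _; rewrite lee_fin ?cylinder_measure_ge0//.
  by apply: le_trans (nP i); have := cylinder_measure_le (mkseq x (n i)); rewrite size_mkseq.
split=> //.
(* [s] codes a G-delta set by a sequence of covers; covers of measure at most [2^-j] give a null one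
   around [X]. *)
apply: (@ideal_base_of_card _ (nat -> nat -> seq nat)
  (fun s => \bigcap_j \bigcup_i cylinder (s j i))).
- exact: card_countType_fun2.
- exact: sub (sing (fun=> 0%N)).
- move=> X /ideal_NP XP.
  have /choice[s sP] : forall j, exists s : nat -> seq nat,
      X `<=` \bigcup_i cylinder (s i) /\
      (\sum_(0 <= i <oo) (mu (s i))%:E <= (2^-1 ^+ j)%:E)%E.
    move=> j; have [|s Xs se] := XP (2^-1 ^+ j); last by exists s.
    by rewrite exprn_gt0// invr_gt0.
  exists s; last by move=> x Xx j _; exact: (sP j).1.
  apply/ideal_NP => e /half_power_lt[j je]; exists (s j); first by move=> x /(_ j I).
  by apply: le_trans (sP j).2 _; rewrite lee_fin.
Qed.

Lemma ideal_N_bigcup (F : nat -> set baire) :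
  (forall n, ideal_N K (F n)) -> ideal_N K (\bigcup_n F n).
Proof.
move=> FN; apply/ideal_NP => e e0.
have /choice[s sP] : forall n, exists s : nat -> seq nat,
    F n `<=` \bigcup_i cylinder (s i) /\
    (\sum_(0 <= i <oo) (mu (s i))%:E <= (e / (2 ^ n.+1)%:R)%:E)%E.
  move=> n; have [|s Fs se] := (ideal_NP (F n)).1 (FN n) (e / (2 ^ n.+1)%:R).
    by rewrite divr_gt0// ltr0n expn_gt0.
  by exists s.
have /ppcard_eqP[f] := card_esym card_nat2.
have s0 n i : (0 <= (mu (s n i))%:E)%E by rewrite lee_fin cylinder_measure_ge0.
exists (fun j => s (f j).1 (f j).2).
  move=> x [n _ /(sP n).1[i _ si]].
  have [j _ fj] : exists2 j, setT j & f j = (n, i) by exact: (@surj _ _ setT setT f).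
  by exists j => //; rewrite fj.
apply: le_trans (epsilon_trick0 xpredT (ltW e0)).
apply: le_trans (lee_nneseries _ (fun n _ => (sP n).2)); last first.
  by move=> n _ _; exact: nneseries_ge0.
rewrite nneseries_esumT//.
rewrite (nneseries_esumT (a := fun n => (\sum_(0 <= i <oo) (mu (s n i))%:E)%E)); last first.
  by move=> n; exact: nneseries_ge0.
under [X in (_ <= X)%E]eq_esum => n _ do rewrite nneseries_esumT//.
rewrite esum_esum//.
rewrite (_ : setXR _ _ = setT); last by apply/seteqP.
by rewrite (reindex_esum setT _ f)//; exact: bij.
Qed.

(* [condm t s] is the measure of [cylinder s] relative to [cylinder t]. *)
Fixpoint condm (t s : seq nat) : K :=
  match t, s with
  | [::], _ => mu s
  | _ :: _, [::] => 1
  | a :: t', b :: s' => if a == b then condm t' s' else 0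
  end.

Lemma condm_ge0 t s : 0 <= condm t s.
Proof.
elim: t s => [|a t IH] [|b s] //=; rewrite ?cylinder_measure_ge0//.
by case: ifP.
Qed.

Lemma condm_self s : condm s s = 1.
Proof. by elim: s => [|a s IH] /=; rewrite ?eqxx// /cylinder_measure big_nil. Qed.

Lemma sum_half_powers : (\sum_(0 <= n <oo) (2^-1 ^+ n.+1 : K)%:E = 1)%E.
Proof.
have := @cvg_geometric_eseries_half K 1 0; rewrite expr0 divr1.
move=> /cvg_lim <-//; apply: congr_lim; apply/funext => n /=.
apply: eq_bigr => i _; congr _%:E.
by rewrite addn1 div1r exprVn natrX.
Qed.

(** Total probability over the children [rcons t n] of [t], whose relative weights are
    [2^-(n+1)]. *)
Lemma condm_split t s :
  (\sum_(0 <= n <oo) (2^-1 ^+ n.+1 * condm (rcons t n) s)%:E = (condm t s)%:E)%E.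
Proof.
elim: t s => [|a t IH] [|b s] /=.
- under eq_eseriesr do rewrite mulr1.
  by rewrite sum_half_powers /cylinder_measure big_nil.
- rewrite (nneseriesD1 (n := b))//; last first.
    move=> n _; rewrite lee_fin mulr_ge0 ?exprn_ge0 ?invr_ge0//.
    by case: ifP; rewrite ?cylinder_measure_ge0.
  rewrite eqxx eseries0 ?adde0 ?cylinder_measure_cons//.
  by move=> i _ /negbTE ->; rewrite mulr0.
- under eq_eseriesr do rewrite mulr1.
  exact: sum_half_powers.
- case: eqP => _; first exact: IH.
  by rewrite eseries0// => i _ _; rewrite mulr0.
Qed.

(* If a cover had total measure below 1, one could descend through cylinders
   in which its relative measure stays below 1, and the branch so obtained
   would not be covered. *)
Lemma ideal_N_proper : ~ ideal_N K setT.
Proof.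
move=> /ideal_NP/(_ 2^-1)[|s sT s12]; first by rewrite invr_gt0.
pose S t := (\sum_(0 <= i <oo) (condm t (s i))%:E)%E.
have S0 t : (0 <= S t)%E by apply: nneseries_ge0 => i _ _; rewrite lee_fin condm_ge0.
(* If every child had relative measure at least 1, so would their weighted average, which is
   [S t]. *)
have /choice[next nextP] : forall t, exists n, (S t < 1 -> S (rcons t n) < 1)%E.
  move=> t; apply: contrapT => /forallNP nS.
  have [St _] := (not_implyP _ _).1 (nS 0%N).
  have Sn n : (1 <= S (rcons t n))%E.
    by have [_ /negP] := (not_implyP _ _).1 (nS n); rewrite -leNgt.
  move: St; apply/negP; rewrite -leNgt -sum_half_powers.
  have -> : S t = (\sum_(0 <= n <oo) ((2^-1 ^+ n.+1)%:E * S (rcons t n)))%E.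
    rewrite /S; under eq_eseriesr do rewrite -condm_split.
    rewrite nneseries_interchange; last first.
      by move=> i j; rewrite lee_fin mulr_ge0 ?condm_ge0 ?exprn_ge0 ?invr_ge0.
    apply: eq_eseriesr => n _; rewrite -nneseriesZl//.
    by move=> i _; rewrite lee_fin condm_ge0.
  apply: lee_nneseries => n _; first by rewrite lee_fin exprn_ge0 ?invr_ge0.
  by rewrite lee_pemulr// ?lte_fin ?exprn_gt0 ?invr_gt0.
pose t := fix t j := if j is j'.+1 then rcons (t j') (next (t j')) else [::].
pose x : baire := fun j => next (t j).
have xt j : mkseq x j = t j by elim: j => // j IH; rewrite mkseqS IH.
have St j : (S (t j) < 1)%E.
  elim: j => [|j IH]; last exact: nextP.
  by apply: le_lt_trans s12 _; rewrite lte_fin invf_lt1 ?ltr1n.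
have [i _] := sT x I; rewrite /cylinder /= xt => ti.
(* The branch enters the [i]-th cylinder of the cover, whose measure relative to itself is already
   1. *)
have := St (size (s i)); rewrite ti; apply/negP; rewrite -leNgt.
rewrite /S (nneseriesD1 (n := i))//; last by move=> n _; rewrite lee_fin condm_ge0.
rewrite condm_self leeDl//; apply: nneseries_ge0 => n _ _.
by rewrite lee_fin condm_ge0.
Qed.

End NullIdeal.

(** * Countable sets of reals *)

Lemma countable_enum (T : Type) (A : set T) (t0 : T) : A #<= [set: nat] ->
  exists a : nat -> T, A `<=` range a /\ forall n, A (a n) \/ a n = t0.
Proof.
rewrite (card_le_eql (card_setT_sym _)) => /card_leTTP[f finj].
have [[x0 _]|nx] := pselect (exists x : A, True); last first.
  exists (fun=> t0); split=> [x Ax|n]; last by right.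
  by case: nx; exists (SigSub (mem_set Ax)).
have [g fK] := inj_section x0 finj.
exists (fun n => val (g n)); split=> [x Ax|n]; last by left; exact: set_mem (valP (g n)).
by exists (f (SigSub (mem_set Ax))) => //; rewrite fK.
Qed.

(** Diagonal bound: at coordinate [n] only the first [n] reals count, so their values fit in a
    slalom, their maximum dominates, and the maximum plus one is avoided. *)
Lemma countable_rel_bounded (R : baire_rel) (A : set baire) :
  R = in_star \/ R = le_star \/ R = neq_star -> A #<= [set: nat] ->
  exists z, forall x, A x -> R x z.
Proof.
move=> hR /(countable_enum (fun=> 0%N))[a [Aa _]].
pose y n := \max_(i < n) a i n.
have ley j n : (j < n)%N -> (a j n <= y n)%N.
  by move=> jn; exact: (@leq_bigmax _ (fun i : 'I_n => a i n) (Ordinal jn)).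
case: hR => [->|[->|->]].
- have sP n : (#|` [fset v in mkseq (a^~ n) n]%fset| <= n)%N.
    by rewrite card_fseq (leq_trans (size_undup _))// size_mkseq.
  exists (Slalom sP) => x /Aa[j _ <-]; exists j.+1 => // n /= jn.
  by rewrite inE /=; apply/mapP; exists j; rewrite // mem_iota.
- by exists y => x /Aa[j _ <-]; exists j.+1 => // n /= jn; exact: ley.
- exists (fun n => (y n).+1) => x /Aa[j _ <-]; exists j.+1 => // n /= jn.
  by rewrite neq_ltn ltnS ley.
Qed.

Lemma rel_unbounded (R : baire_rel) :
  R = in_star \/ R = le_star \/ R = neq_star -> unbounded R setT.
Proof.
case=> [->|[->|->]] [z zP].
- have [|N _ /(_ N (leqnn N))/=] := zP (fun n => (\max_(i <- z n) i).+1) _ => //.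
  by move=> /(@leq_bigmax_seq _ _ xpredT id)/(_ isT); rewrite ltnn.
- have [|N _ /(_ N (leqnn N))/=] := zP (fun n => (z n).+1) _ => //.
  by rewrite ltnn.
- have [|N _ /(_ N (leqnn N))/=] := zP z _ => //.
  by rewrite eqxx.
Qed.

(** * Cardinal arithmetic and the two cases *)

Lemma lt_functions_pow (k : cardinal) (m : Type) (a : k) :
  [set: m] #<= [set x : k | clt x a] -> [set: m -> k] #<= [set: lt_functions k].
Proof.
move=> ma; pose D := {x : k | clt x a}.
have mD : [set: m] #<= [set: D].
  apply: card_le_trans ma _; rewrite (card_le_eql (card_setT_sym _)).
  apply: (@inj_card_leTT _ _ (fun x => exist _ (val x) (set_mem (valP x)))).
  by move=> x y [] /val_inj.
apply: card_le_trans (card_fun_le mD (card_lexx [set: k]) a) _.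
pose fn (f : D -> k) : lt_functions k :=
  existT (fun b => {x : k | clt x b} -> k) a f.
apply: (@inj_card_leTT _ _ fn) => f g fg.
(* Extending by the default [a] turns an equality of dependent pairs into one of plain functions. *)
pose ext (t : lt_functions k) x :=
  if pselect (clt x (projT1 t)) is left xt then projT2 t (exist _ x xt) else a.
have extE h x : ext (fn h) (sval x) = h x.
  rewrite /ext /=; case: pselect => [xa|[]]; last exact: (svalP x).
  by congr h; exact: val_inj.
by apply/funext => x; rewrite -(extE f) -(extE g) fg.
Qed.

Lemma aleph1_card_le (k l : cardinal) :
  is_aleph1 k -> is_aleph1 l -> [set: k] #<= [set: l].
Proof.
move=> [m mnat [_ ksucc]] [n nnat [nl _]]; apply: ksucc => lm; apply: nl.
by rewrite (card_le_eqr nnat) -(card_le_eqr mnat).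
Qed.

Theorem theorem2p1 (K : realType) (R : baire_rel) (I : set (set baire))
    (hR : R = in_star \/ R = le_star \/ R = neq_star)
    (hI : I = ideal_K \/ I = ideal_M \/ I = ideal_N K) :
  (forall c : cardinal,
     is_continuum c ->
     [set: lt_functions c] #= [set: c] ->
     is_successor_cardinal c ->
     is_b R c -> is_add I c ->
     (exists k : cardinal, is_b (@lift_rel R I) k /\ is_b (@cle_star c) k) /\
     (exists k : cardinal, is_d (@lift_rel R I) k /\ is_d (@cle_star c) k)) /\
  (CH ->
   forall w1 : cardinal,
     is_aleph1 w1 ->
     (exists k : cardinal, is_b (@lift_rel R I) k /\ is_b (@cle_star w1) k) /\
     (exists k : cardinal, is_d (@lift_rel R I) k /\ is_d (@cle_star w1) k)).
Proof.
have [I_ideal I_bigcup I_proper] : [/\ ideal_with_base I,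
    forall F : nat -> set baire, (forall n, I (F n)) -> I (\bigcup_n F n) & ~ I setT].
  case: hI => [->|[->|->]].
  - split; [exact: ideal_K_with_base|exact: ideal_K_bigcup|exact: ideal_K_proper].
  - split; [exact: ideal_M_with_base|exact: ideal_M_bigcup|exact: ideal_M_proper].
  - split; [exact: ideal_N_with_base|exact: ideal_N_bigcup|exact: ideal_N_proper].
split=> [c c_continuum lt_c [m m_succ] [[A0 A0unb _] b_min] [_ add_min]|].
  have small_union (F : set (set baire)) :
      ~ ([set: c] #<= F) -> F `<=` I -> I (\bigcup_(A in F) A).
    by move=> sF FI; apply: contrapT => nF; apply/sF/add_min.
  have mc : [set: m] #<= [set: c].
    by have [//|cm] := card_leTT_total m c; case: m_succ => /(_ cm).
  apply: (@lift_rel_b_d c m) => //.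
  - by move=> T A; exact: succ_small_le.
  - rewrite -(card_le_eqr lt_c).
    have /card_leTTP[j jinj] := mc.
    (* [range j] is small, hence strictly below some [r x]; so [m] embeds into a proper segment and
       [c^m] is at most [c^{<c}]. *)
    have [r [_ runb]] := ideal_rank c_continuum I_ideal small_union I_proper.
    have [|x xP] := runb (range j).
      by move=> cj; case: m_succ.1; apply: card_le_trans cj (card_image_le _ _).
    apply: (@lt_functions_pow c m (r x)); apply: (@set_inj_card_le _ _ _ _ j).
      by move=> i _; apply: xP; exists i.
    by move=> i i' _ _; exact: jinj.
  - rewrite (card_le_eqr c_continuum); apply: card_le_trans card_continuum_prod.
    by apply: card_prod_le; rewrite -(card_le_eqr c_continuum).
  - by move=> A sA; apply: contrapT => nA; apply/sA/b_min.
  - by move=> [z zP]; apply: A0unb; exists z => x _; exact: zP.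
move=> [k k1 k_continuum] w1 w1_aleph1.
have w1_continuum : is_continuum w1.
  by apply: card_eq_trans k_continuum; rewrite card_eq_le !aleph1_card_le.
have [m mnat m_succ] := w1_aleph1.
(* Under CH small means countable: diagonal bounds and countable unions supply the smallness
   hypotheses, and the power by [m] is a countable one. *)
have small_countable (T : Type) (A : set T) : ~ ([set: w1] #<= A) -> A #<= [set: nat].
  by rewrite -(card_le_eqr mnat); exact: succ_small_le.
have w1_ge : [set: nat -> bool] #<= [set: w1] by rewrite (card_le_eqr w1_continuum).
have w1_le : [set: w1] #<= [set: nat -> bool] by rewrite (card_le_eql w1_continuum).
have m_le : [set: m] #<= [set: nat] by rewrite (card_le_eql mnat).
have /card_leTTP[w _] := w1_ge.
apply: (@lift_rel_b_d w1 m) => //.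
- by move=> T A; exact: succ_small_le.
- apply: card_le_trans w1_ge; apply: card_le_trans card_seq_continuum.
  exact: card_fun_le m_le w1_le (w (fun=> true)).
- apply: card_le_trans w1_ge; apply: card_le_trans card_continuum_prod.
  apply: card_prod_le => //; apply: card_le_trans m_le _.
  apply: (@inj_card_leTT _ _ (fun n i => i == n)) => n p np; apply/eqP.
  by have := congr1 (@^~ n) np; rewrite eqxx => <-.
- by move=> A /small_countable; exact: countable_rel_bounded.
- exact: rel_unbounded.
- move=> F /small_countable/(countable_enum set0)[a [Fa aF]] FI.
  have I0 : I set0 by apply: (ideal_sub I_ideal) (ideal_singleton I_ideal (fun=> 0%N)).
  apply: (ideal_sub I_ideal) (I_bigcup a _) => [x [A /Fa[n _ <-] ax]|n]; first by exists n.
  by case: (aF n) => [/FI|->].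
Qed.
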